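(* Consider the two-way unsplittable trading problem with at most $k\ge 2$ trades, where all prices lie in some interval $[m,M]$ with $M/m=\varphi>1$, the value $\varphi$ is known to the online algorithm, but $m$ and $M$ are not. Consider the following online algorithm: upon release of the $i$-th price $p(i)$, if $i=T$ and it holds stock, it sells at price $p(T)$; otherwise (if $i<T$), it sets $M_i=\max(p(1),\ldots,p(i))$, and if $p(i)\le M_i/\varphi^{2/3}$, it currently holds no stock and it has not used up all $k$ trades, it buys at price $p(i)$; else if it currently holds stock bought at price $p(b)$ and $p(i)\ge \varphi^{1/3}p(b)$, it sells at price $p(i)$. Then this algorithm has competitive ratio $\varphi^{(2k+2)/3}$ (i.e., on every admissible price sequence the return of the optimal offline algorithm is at most $\varphi^{(2k+2)/3}$ times the return of this algorithm).
   Context: Two-way unsplittable trading problem: a sequence of prices $p(1),\ldots,p(T)$ (positive reals), one per day, is revealed online; the horizon length $T$ is not known to the online algorithm in advance, but when day $i$ arrives the algorithm learns whether $i=T$. The investor starts with cash and may make at most $k$ trades. A trade is a pair of days $(b,s)$ with $b<s$: on day $b$ all available money is used to buy the stock at price $p(b)$, and on day $s$ all stock is sold at price $p(s)$. Trades cannot overlap (a sale must happen before the next purchase), there is no short selling, no buying on the last day $T$, and any stock held on day $T$ is sold at price $p(T)$. The gain of a trade $(b,s)$ is $p(s)/p(b)$; the return is the product of the gains of the trades made ($1$ if none). OPT is the optimal offline algorithm making at most $k$ trades. The competitive ratio of an online algorithm is the supremum over admissible price sequences of (return of OPT)/(return of the algorithm). In this model the admissible price sequences are those whose prices all lie in some interval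 $[m,M]$ with $M/m=\varphi$; only $\varphi$ is known to the algorithm. *)

(* Defs.v *)
From HB Require Import structures.
From mathcomp Require Import all_boot all_order all_algebra.
From mathcomp Require Import all_classical all_reals all_analysis.

Set Implicit Arguments.
Unset Strict Implicit.
Unset Printing Implicit Defensive.

Import Order.TTheory GRing.Theory Num.Theory.
Local Open Scope classical_set_scope.
Local Open Scope ring_scope.

(* Days are numbered from 0: the price sequence p(1), ..., p(T) is a [seq R] of
   size T, day i + 1 of the mathematical text is index i, and the last day is
   index T - 1.  A trade is a pair (day of purchase, day of sale); a schedule
   lists trades in chronological order. *)
Definition trade : Type := (nat * nat)%type.

Section Trading.
Variable R : realType.
Implicit Types (p : seq R) (ts : seq trade).

Definition gain p (t : trade) : R := nth 0 p t.2 / nth 0 p t.1.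

Definition schedule_return p ts : R := \prod_(t <- ts) gain p t.

Definition feasible (k : nat) p ts : bool :=
  [&& (size ts <= k)%N,
      all (fun t : trade => (t.1 < t.2 < size p)%N) ts
    & sorted (fun t u : trade => (t.2 < u.1)%N) ts].

(* The set of values is finite and contains 1 (no trade), so this supremum is a
   maximum. *)
Definition opt_return (k : nat) p : R :=
  sup [set schedule_return p ts | ts in [set ts | feasible k p ts]].

Definition admissible (phi : R) p : Prop :=
  (0 < size p)%N /\
  exists m M : R, [/\ 0 < m, M / m = phi & forall x, x \in p -> m <= x <= M].

Definition competitive_ratio (phi : R) (k : nat) (alg : seq R -> seq trade) :
    \bar R :=
  ereal_sup [set (opt_return k p / schedule_return p (alg p))%:E
            | p in admissible phi].

Record state := State {
  bought : option nat;   (* day of purchase of the stock currently held *)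
  completed : seq trade
}.

Definition running_max p : R := \big[Num.max/0]_(x <- p) x.

(* One day of the algorithm: [h] is the nonempty sequence of prices revealed so
   far, today's included, and [final] tells whether today is the last day.  When
   no stock is held, the trades used are exactly the completed ones. *)
Definition step (phi : R) (k : nat) (h : seq R) (final : bool) (st : state) :
    state :=
  let i := (size h).-1 in
  let price := nth 0 h in
  match bought st with
  | None =>
      if [&& ~~ final, price i <= running_max h / phi `^ (2 / 3)
           & (size (completed st) < k)%N]
      then State (Some i) (completed st) else st
  | Some b =>
      if final || (phi `^ (1 / 3) * price b <= price i)
      then State None (rcons (completed st) (b, i)) else st
  end.

Definition threshold_alg (phi : R) (k : nat) (p : seq R) : seq trade :=
  completed (foldl (fun st i => step phi k (take i.+1 p) (i.+1 == size p) st)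
                   (State None [::]) (iota 0 (size p))).

End Trading.

(* Main.v *)
Require Import Defs.
From HB Require Import structures.
From mathcomp Require Import all_boot all_order all_algebra.
From mathcomp Require Import all_classical all_reals all_analysis.
From mathcomp Require Import zify ring.

Import Order.TTheory GRing.Theory Num.Theory.
Local Open Scope ring_scope.

(** Put [a := phi `^ (1/3)], so that prices lie in [[m, a^3 m]].  Let [c i] be
    the number of sales of the algorithm up to day [i] that realised a gain of
    at least [a], and consider the potential
    [Psi i := max (M_i, a^2 m) * a^(c i)].  As long as the algorithm has not
    exhausted its [k] trades, every trade [(i, j)] gains at most
    [a^2 * Psi j / Psi i]: if the algorithm does not hold stock at the end of
    day [i], then [p i >= max (M_i, a^2 m) / a^2]; if it does, prices stay in
    [[m, a^2 m]] until its sale, which increments [c].  Telescoping over the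
    trades of OPT bounds its return by [a^(2 k) * a * a^(c T)], the factor [a]
    being the largest possible variation of [max (M_i, a^2 m)].  On the other
    hand the algorithm earns at least [a^(c T) / a], because only its last
    sale, forced on day [T], can gain less than [a], and it buys at a price at
    most [a m].  If the [k] trades are exhausted, OPT earns at most [a^(3 k)],
    and the algorithm at least [a^k]. *)

(** * Returns of arbitrary schedules *)

Section Schedules.
Variables (R : realType) (p : seq R).
Hypothesis p_gt0 : forall x, x \in p -> 0 < x.

Lemma gain_gt0 (t : trade) : (t.1 < t.2 < size p)%N -> 0 < gain p t.
Proof.
move=> /andP[t12 t2]; rewrite /gain divr_gt0 // p_gt0 // mem_nth //.
exact: ltn_trans t12 t2.
Qed.

Lemma exp_le_schedule_return (a : R) (ts : seq trade) : 0 <= a ->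
  all (fun t => a <= gain p t) ts -> a ^+ size ts <= schedule_return p ts.
Proof.
move=> a0; rewrite /schedule_return; elim: ts => [|t ts ih] /=.
  by rewrite big_nil.
move=> /andP[at_ /ih {}ih]; rewrite big_cons exprS.
by rewrite ler_pM // exprn_ge0.
Qed.

(** Since [F] is nondecreasing, the idle stretches around the trades can only raise the telescoped
    bound. The start day [x] is left free so that the induction can resume at the sale day of the
    first trade. *)
Lemma schedule_return_telescope (A : R) (F : nat -> R) (x : nat)
    (ts : seq trade) :
  0 <= A ->
  (forall i, 0 < F i) -> {homo F : i j / (i <= j)%N >-> i <= j} ->
  (forall i j, (i < j < size p)%N -> gain p (i, j) <= A * (F j / F i)) ->
  (x < size p)%N ->
  all (fun t => t.1 < t.2 < size p)%N ts ->
  all (fun t => x <= t.1)%N ts ->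
  sorted (fun t u => t.2 < u.1)%N ts ->
  schedule_return p ts <= A ^+ size ts * (F (size p).-1 / F x).
Proof.
move=> A0 F0 Fmono gainF; rewrite /schedule_return.
elim: ts x => [|t ts ih] x xp /=.
  move=> _ _ _; rewrite big_nil expr0 mul1r ler_pdivlMr // mul1r.
  by apply: Fmono; lia.
move=> /andP[tp tsp] /andP[xt _] tts; rewrite big_cons exprS.
(* The order [t.2 < u.1] alone is not transitive on arbitrary pairs; adding [u.1 < u.2] makes it
   so. *)
have tr : transitive (fun t u : trade => [&& t.2 < u.1 & u.1 < u.2]%N).
  by move=> u v w /andP[h1 h2] /andP[h3 h4]; rewrite h4 andbT; lia.
have tts' : path (fun t u : trade => [&& t.2 < u.1 & u.1 < u.2]%N) t ts.
  elim: ts t tts tsp {ih tp xt} => [//|u ts ihu] t /= /andP[tu us].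
  by move=> /andP[/andP[-> _] tsp]; rewrite tu ihu.
have ht2 : all (fun u => t.2 <= u.1)%N ts.
  have := order_path_min tr tts'; apply: sub_all => u /andP[h _].
  exact: ltnW.
have t2p : (t.2 < size p)%N by case/andP: tp.
have := ih t.2 t2p tsp ht2 (path_sorted tts) => {}ih.
have Ft : gain p t <= A * (F t.2 / F t.1) by case: (t) tp => i j; exact: gainF.
apply: (@le_trans _ _ (A * (F t.2 / F t.1) *
                      (A ^+ size ts * (F (size p).-1 / F t.2)))).
  apply: ler_pM => //; first exact/ltW/gain_gt0.
  elim: (ts) tsp => [|u us ihu] /=; first by rewrite big_nil.
  by move=> /andP[up usp]; rewrite big_cons mulr_ge0 ?ihu // ltW // gain_gt0.
have -> : A * (F t.2 / F t.1) * (A ^+ size ts * (F (size p).-1 / F t.2))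
    = A * A ^+ size ts * (F (size p).-1 / F t.1).
  by field; rewrite !gt_eqF.
apply: ler_wpM2l; first by rewrite mulr_ge0 // exprn_ge0.
by rewrite ler_pM2l // lef_pV2 ?posrE // Fmono.
Qed.

End Schedules.

(** * Price bounds and the running maximum with a floor *)

Section Threshold.
Variables (R : realType) (phi a m : R) (k : nat) (p : seq R).
Hypothesis a_gt1 : 1 < a.
Hypothesis m_gt0 : 0 < m.
Hypothesis phi13 : phi `^ (1 / 3) = a.
Hypothesis phi23 : phi `^ (2 / 3) = a ^+ 2.
Hypothesis p_bounds : forall x, x \in p -> m <= x <= a ^+ 3 * m.

Let a_gt0 : 0 < a := lt_trans ltr01 a_gt1.
Let price (i : nat) : R := nth 0 p i.

(* The floor [a^2 m] makes this vary by a factor at most [a] rather than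
   [a^3]. *)
Let peak (i : nat) : R := Num.max (running_max (take i.+1 p)) (a ^+ 2 * m).

Let price_gt0 x : x \in p -> 0 < x.
Proof. by move=> /p_bounds/andP[+ _]; apply: lt_le_trans. Qed.

Let price_ge i : (i < size p)%N -> m <= price i.
Proof. by move=> ip; have /andP[] := p_bounds _ (mem_nth 0 ip). Qed.

Let price_le i : (i < size p)%N -> price i <= a ^+ 3 * m.
Proof. by move=> ip; have /andP[] := p_bounds _ (mem_nth 0 ip). Qed.

Let running_max_le i : running_max (take i p) <= a ^+ 3 * m.
Proof.
rewrite /running_max big_seq; apply: bigmax_le => [|x /mem_take/p_bounds/andP[]//].
by rewrite ltW // mulr_gt0 // exprn_gt0.
Qed.

Let price_le_peak i : (i < size p)%N -> price i <= peak i.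
Proof.
move=> ip; rewrite /peak le_max; apply/orP; left.
apply: (le_bigmax_seq 0 (price i) xpredT id) => //.
rewrite /price -(nth_take 0 (ltnSn i)) mem_nth // size_take.
by case: ifP => //; lia.
Qed.

Let peak_ge i : a ^+ 2 * m <= peak i.
Proof. by rewrite le_max lexx orbT. Qed.

Let peak_gt0 i : 0 < peak i.
Proof. by apply: lt_le_trans (peak_ge i); rewrite mulr_gt0 // exprn_gt0. Qed.

Let peak_le i : peak i <= a ^+ 3 * m.
Proof.
rewrite ge_max running_max_le /= ler_pM2r //.
by rewrite ler_eXn2l.
Qed.

Let peak_homo : {homo peak : i j / (i <= j)%N >-> i <= j}.
Proof.
move=> i j ij; rewrite /peak ge_max !le_max lexx orbT andbT.
apply/orP; left; rewrite {1}/running_max big_seq.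
apply: bigmax_le => [|x xi]; first exact: bigmax_ge_id.
apply: (le_bigmax_seq 0 x xpredT id) => //.
move: xi; rewrite -(@take_takel _ i.+1 j.+1 p) //; exact: mem_take.
Qed.

(** * Invariant of the run before the last day *)

Definition below_until (i n : nat) : Prop :=
  forall j, (i <= j < n)%N -> price j <= a ^+ 2 * m.

(* [ss] lists the sale days of the algorithm, [hold] tells whether it still
   holds stock and [n] is the number of elapsed days. *)
Definition day_ok (ss : seq nat) (hold : bool) (n i : nat) : Prop :=
  [\/ peak i <= a ^+ 2 * price i,
      exists2 s, s \in ss & (i < s)%N /\ below_until i s
    | hold /\ below_until i n].

(** The last clause is guarded because an algorithm out of trades lets low prices pass. The bound on
    [price b] limits the loss of a forced sale. *)
Definition run_inv (n : nat) (st : state) : Prop :=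
  [/\ all (fun t => (t.1 < t.2 < n)%N && (a <= gain p t)) (completed st),
      (size (completed st) <= k)%N,
      forall b, bought st = Some b ->
        [/\ (b < n)%N, (size (completed st) < k)%N & price b <= a * m]
    & (size (completed st) < k)%N -> forall i, (i < n)%N ->
        day_ok (map snd (completed st)) (bought st) n i].

Lemma stepE n fin st : (n < size p)%N ->
  (forall b, bought st = Some b -> (b <= n)%N) ->
  step phi k (take n.+1 p) fin st =
  match bought st with
  | None =>
      if [&& ~~ fin, price n <= running_max (take n.+1 p) / a ^+ 2
           & (size (completed st) < k)%N]
      then State (Some n) (completed st) else st
  | Some b =>
      if fin || (a * price b <= price n)
      then State None (rcons (completed st) (b, n)) else st
  end.
Proof.
move=> np hb; rewrite /step phi13 phi23.
have -> : (size (take n.+1 p)).-1 = n by rewrite size_takel.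
rewrite nth_take //.
by case: (bought st) hb => // b /(_ b erefl) bn; rewrite nth_take.
Qed.

Lemma le_gain b s : (b < size p)%N -> (a <= gain p (b, s)) = (a * price b <= price s).
Proof.
by move=> bp; rewrite /gain ler_pdivlMr // (lt_le_trans m_gt0) // price_ge.
Qed.

Lemma run_inv_step n st : (n.+1 < size p)%N -> run_inv n st ->
  run_inv n.+1 (step phi k (take n.+1 p) false st).
Proof.
move=> np [hall hk hb hok]; have n_p : (n < size p)%N by lia.
have hall' : all (fun t => (t.1 < t.2 < n.+1)%N && (a <= gain p t)) (completed st).
  by apply: sub_all hall => t /andP[h ->]; rewrite andbT; lia.
rewrite stepE //; last by move=> b /hb[]; lia.
have pn := price_ge _ n_p.
case E : (bought st) => [b|] /=.
  have [bn bk bm] := hb b E; rewrite E /= in hok.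
  have b_p : (b < size p)%N by lia.
  have pb := price_ge _ b_p.
  case: ifP => [sell|/negbT]; rewrite /run_inv /=.
    rewrite all_rcons size_rcons /= hall' bn ltnSn le_gain // sell /=.
    split => // _ i; rewrite ltnS leq_eqVlt => /predU1P[->|i_n].
      (* A voluntary sale has price at least [a * m], and [a ^+ 2] times this is the upper bound of
         [peak]. *)
      apply: Or31; apply: le_trans (peak_le _) _.
      rewrite exprSr -mulrA ler_pM2l ?exprn_gt0 //.
      by apply: le_trans sell; rewrite ler_pM2l.
    have [h|[s ss h]|[_ h]] := hok bk i i_n; first exact: Or31.
      by apply: Or32; exists s => //; rewrite map_rcons mem_rcons inE ss orbT.
    by apply: Or32; exists n => //; rewrite map_rcons mem_rcons inE eqxx.
  rewrite -ltNge => low.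
  (* Stock bought for at most [a * m] is kept only below [a] times its purchase price. *)
  have low' : price n <= a ^+ 2 * m.
    apply: le_trans (ltW low) _; rewrite expr2 -mulrA.
    by rewrite ler_pM2l.
  split => //; first by move=> c; rewrite E => -[<-]; split => //; lia.
  move=> _ i; rewrite E ltnS leq_eqVlt => /predU1P[->|i_n].
    by apply: Or33; split => // j jn; have -> : j = n by lia.
  have [h|h|[_ h]] := hok bk i i_n; [exact: Or31|exact: Or32|].
  apply: Or33; split => // j jn.
  have [->//|jn'] := eqVneq j n; apply: h; lia.
rewrite E /= in hok.
case: ifP => [/andP[buy sk]|/negbT]; rewrite /run_inv /=.
  (* The running maximum is at most [a ^+ 3 * m], and the purchase threshold divides it by
     [a ^+ 2]. *)
  have buy' : price n <= a * m.
    apply: le_trans buy _; rewrite ler_pdivrMr ?exprn_gt0 //.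
    have -> : a * m * a ^+ 2 = a ^+ 3 * m by ring.
    exact: running_max_le.
  split => //; first by move=> c [<-]; split.
  move=> _ i; rewrite ltnS leq_eqVlt => /predU1P[->|i_n].
    apply: Or33; split => // j jn; have -> : j = n by lia.
    apply: le_trans buy' _; rewrite ler_pM2r // expr2.
    by rewrite ler_peMr // ltW.
  by have [h|h|[]//] := hok sk i i_n; [exact: Or31|exact: Or32].
move=> nbuy; split => //; first by move=> c; rewrite E.
move=> sk i; rewrite ltnS leq_eqVlt E => /predU1P[->|i_n].
  (* With trades left, not buying means a price above the threshold; the floor in [peak] is handled
     by [m <= price n]. *)
  move: nbuy; rewrite sk andbT -ltNge ltr_pdivrMr ?exprn_gt0 // => nbuy.
  apply: Or31; rewrite ge_max mulrC (ltW nbuy) /= mulrC.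
  by rewrite ler_pM2r ?exprn_gt0.
by have [h|h|[]//] := hok sk i i_n; [exact: Or31|exact: Or32].
Qed.

Lemma run_inv_fold n : (n < size p)%N ->
  run_inv n (foldl (fun st i => step phi k (take i.+1 p) (i.+1 == size p) st)
                   (State None [::]) (iota 0 n)).
Proof.
elim: n => [|n ih] np; first by split.
rewrite -addn1 iotaD cats1 foldl_rcons add0n.
(* The last day is not reached here, so no sale is forced. *)
rewrite (_ : (n.+1 == size p) = false); last by lia.
by rewrite addn1; apply: run_inv_step => //; apply: ih; lia.
Qed.

(** [ss] omits a forced sale of gain below [a]. The days of that unfinished holding are then covered
    by the third case of [day_ok], prices having stayed low to the end. *)
Lemma threshold_alg_spec : (0 < size p)%N ->
  exists2 ss : seq nat,
    a ^+ size ss <= a * schedule_return p (threshold_alg phi k p)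
  & size ss = k \/
    forall i, (i < (size p).-1)%N -> day_ok ss true (size p) i.
Proof.
move=> p0; rewrite /threshold_alg.
set n := (size p).-1.
have np : (n < size p)%N by rewrite /n; lia.
have pE : size p = n.+1 by rewrite /n; lia.
have [hall hk hb hok] := run_inv_fold n np.
rewrite {2}pE -addn1 iotaD cats1 foldl_rcons add0n.
move: hall hk hb hok; set st := foldl _ _ _ => hall hk hb hok.
rewrite stepE //; last by move=> b /hb[]; lia.
rewrite -pE eqxx /=.
have ret : a ^+ size (completed st) <= schedule_return p (completed st).
  apply: exp_le_schedule_return; first exact: ltW.
  by apply: sub_all hall => t /andP[].
have szm : size (map snd (completed st)) = size (completed st) by rewrite size_map.
case E : (bought st) => [b|] /=.
  have [bn bk bm] := hb b E; rewrite E /= in hok.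
  have b_p : (b < size p)%N by lia.
  have pb : 0 < price b by apply: lt_le_trans m_gt0 _; exact: price_ge.
  rewrite {1}/schedule_return big_rcons /= [X in a * X]mulrC -/(schedule_return p _).
  have [sell|low] := leP (a * price b) (price n).
    exists (rcons (map snd (completed st)) n).
      rewrite size_rcons szm exprS ler_pM2l //.
      rewrite -[leLHS]mul1r ler_pM //; first by rewrite exprn_ge0 // ltW.
      by apply: (le_trans (ltW a_gt1)); rewrite le_gain.
    right=> i i_n; have [h|[s ss h]|[_ h]] := hok bk i i_n; first exact: Or31.
      by apply: Or32; exists s => //; rewrite mem_rcons inE ss orbT.
    by apply: Or32; exists n => //; rewrite mem_rcons inE eqxx.
  (* The forced sale is at price at least [m] after a purchase at most [a * m], so the extra factor
     [a] compensates it. *)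
  exists (map snd (completed st)).
    rewrite szm mulrA -[leLHS]mul1r ler_pM //; first by rewrite exprn_ge0 // ltW.
    rewrite /gain /= mulrA ler_pdivlMr // mul1r.
    by apply: le_trans bm _; rewrite ler_pM2l // price_ge.
  right=> i i_n; have [h|h|[_ h]] := hok bk i i_n; [exact: Or31|exact: Or32|].
  apply: Or33; split => // j jn.
  have [->|jn'] := eqVneq j n; last by apply: h; lia.
  by apply: le_trans (ltW low) _; rewrite expr2 -mulrA ler_pM2l.
exists (map snd (completed st)).
  rewrite szm; apply: (le_trans ret); rewrite ler_peMl //; last exact: ltW.
  by apply: le_trans ret; rewrite exprn_ge0 // ltW.
rewrite szm; move: hk; rewrite leq_eqVlt => /predU1P[|kk]; [by left|right].
move=> i i_n; rewrite E in hok.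
by have [h|h|[]//] := hok kk i i_n; [exact: Or31|exact: Or32].
Qed.

(** * The potential and the bound on feasible schedules *)

Definition potential (ss : seq nat) (i : nat) : R :=
  peak i * a ^+ count (fun s => s <= i)%N ss.

Lemma potential_gt0 ss i : 0 < potential ss i.
Proof.
by rewrite mulr_gt0 ?exprn_gt0.
Qed.

Let count_homo (ss : seq nat) i j : (i <= j)%N ->
  (count (fun s => s <= i)%N ss <= count (fun s => s <= j)%N ss)%N.
Proof. by move=> ij; apply: sub_count => s /= /leq_trans; apply. Qed.

Lemma potential_homo ss :
  {homo potential ss : i j / (i <= j)%N >-> i <= j}.
Proof.
move=> i j ij; apply: ler_pM.
- exact/ltW/peak_gt0.
- by rewrite exprn_ge0 // ltW.
- exact: peak_homo.
- by rewrite ler_weXn2l ?ltW // count_homo.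
Qed.

Lemma gain_le_potential ss i j : (i < j < size p)%N ->
  day_ok ss true (size p) i ->
  gain p (i, j) <= a ^+ 2 * (potential ss j / potential ss i).
Proof.
move=> /andP[ij jp] ok.
have ip : (i < size p)%N by lia.
have pi0 : 0 < price i by apply: lt_le_trans m_gt0 _; exact: price_ge.
have a2 : 0 < a ^+ 2 by rewrite exprn_gt0.
have pot1 : 1 <= potential ss j / potential ss i.
  by rewrite ler_pdivlMr ?potential_gt0 // mul1r potential_homo // ltnW.
(* As [m <= price i], such a trade gains at most [a ^+ 2], and the potential never decreases. *)
have calm : price j <= a ^+ 2 * m ->
    gain p (i, j) <= a ^+ 2 * (potential ss j / potential ss i).
  move=> pj; rewrite /gain /= ler_pdivrMr //; apply: le_trans pj _.
  rewrite -[leRHS]mulrA ler_pM2l //.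
  by rewrite -[leLHS]mul1r ler_pM //; [exact: ltW|exact: price_ge].
case: ok => [h|[s ss_s [i_s bel]]|[_ bel]]; last by apply: calm; apply: bel; lia.
(* Here the gain is at most [a ^+ 2 * (peak j / peak i)]. *)
- rewrite /gain /= ler_pdivrMr // mulrAC mulrA ler_pdivlMr ?potential_gt0 //.
  rewrite {1}/potential mulrA /potential [leRHS]mulrA; apply: ler_pM.
  + by rewrite mulr_ge0 ?(ltW (peak_gt0 _)) // (le_trans (ltW m_gt0)) // price_ge.
  + by rewrite exprn_ge0 // ltW.
  + rewrite [leRHS]mulrC; apply: ler_pM; rewrite ?(ltW (peak_gt0 _)) ?price_le_peak //.
    by rewrite (le_trans (ltW m_gt0)) // price_ge.
  + by rewrite ler_weXn2l ?ltW // count_homo // ltnW.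
have [j_s|s_j] := ltnP j s; first by apply: calm; apply: bel; lia.
(* Now [i < s <= j]: the gain may reach [a ^+ 3], but the sale [s] is counted at [j] and not at [i],
   which supplies the third factor [a]. *)
rewrite /gain /= ler_pdivrMr //; apply: le_trans (price_le _ jp) _.
have cnt : (count (fun s => s <= i)%N ss < count (fun s => s <= j)%N ss)%N.
  elim: ss ss_s {pot1 calm} => // u us ih; rewrite inE => /predU1P[<-|/ih] /=.
    have := count_homo us i j (ltnW ij); rewrite s_j (leqNgt s i) i_s /=; lia.
  by case: (leqP u i) => [ui|_]; [rewrite (leq_trans ui (ltnW ij))|]; lia.
have pot : a <= potential ss j / potential ss i.
  rewrite ler_pdivlMr ?potential_gt0 // /potential mulrCA -exprS.
  apply: ler_pM.
  - exact/ltW/peak_gt0.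
  - by rewrite exprn_ge0 // ltW.
  - exact/peak_homo/ltnW.
  - by rewrite ler_weXn2l ?ltW.
rewrite exprSr -[leLHS]mulrA -[leRHS]mulrA ler_pM2l //.
by rewrite [leRHS]mulrC mulrC; apply: ler_pM => //; [exact: ltW..|exact: price_ge].
Qed.

(** The sales contribute at most [a ^+ size ss]; [peak], confined between [a ^+ 2 * m] and
    [a ^+ 3 * m], adds one factor [a]. *)
Lemma potential_variation ss :
  potential ss (size p).-1 / potential ss 0%N <= a ^+ (size ss).+1.
Proof.
rewrite ler_pdivrMr ?potential_gt0 // exprS mulrC mulrA.
rewrite [X in X * a ^+ size ss]mulrC.
apply: ler_pM.
- exact/ltW/peak_gt0.
- by rewrite exprn_ge0 // ltW.
- apply: le_trans (peak_le _) _; rewrite exprS -mulrA ler_pM2l //.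
  apply: le_trans (peak_ge 0%N) _; rewrite /potential ler_peMr //.
    exact/ltW/peak_gt0.
  by rewrite exprn_ege1 // ltW.
- by rewrite ler_weXn2l ?ltW // count_size.
Qed.

Lemma schedule_return_le ts : (0 < size p)%N -> feasible k p ts ->
  schedule_return p ts
    <= a ^+ (2 * k + 2) * schedule_return p (threshold_alg phi k p).
Proof.
move=> p0 /and3P[tsk tsp sts].
have [ss alg hss] := threshold_alg_spec p0.
(* The factor [a] set aside here is the one lost by the algorithm in [alg]. *)
suff h : schedule_return p ts <= a ^+ (2 * k + 1) * a ^+ size ss.
  apply: le_trans h _.
  by rewrite (addnS _ 1) exprSr -[leRHS]mulrA ler_pM2l ?exprn_gt0.
have ts0 : all (fun t => 0 <= t.1)%N ts by apply/allP.
case: hss => [->|ok].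
  (* With all [k] trades used, the constant potential [1] suffices: each trade gains at most
     [a ^+ 3], and [3 * k <= (2 * k + 1) + k]. *)
  apply: le_trans (_ : (a ^+ 3) ^+ size ts * (1 / 1) <= _).
    apply: (@schedule_return_telescope _ _ price_gt0 (a ^+ 3) (fun=> 1) 0) => //.
    - by rewrite exprn_ge0 // ltW.
    - move=> i j /andP[ij jp]; have ip : (i < size p)%N by lia.
      rewrite divr1 mulr1 /gain /= ler_pdivrMr ?price_gt0 ?mem_nth //.
      apply: le_trans (price_le _ jp) _.
      by rewrite ler_pM2l ?exprn_gt0 // price_ge.
  rewrite divr1 mulr1 -exprM -exprD ler_weXn2l ?ltW //; lia.
apply: le_trans (_ : (a ^+ 2) ^+ size ts *
    (potential ss (size p).-1 / potential ss 0%N) <= _).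
  apply: (@schedule_return_telescope _ _ price_gt0) => //.
  - by rewrite exprn_ge0 // ltW.
  - exact: potential_gt0.
  - exact: potential_homo.
  - by move=> i j ijp; apply: gain_le_potential => //; apply: ok; lia.
apply: le_trans (ler_wpM2l _ (potential_variation ss)) _.
  by rewrite !exprn_ge0 // ltW.
by rewrite -exprM -!exprD ler_weXn2l ?ltW //; lia.
Qed.

Lemma opt_return_le : (0 < size p)%N ->
  opt_return k p / schedule_return p (threshold_alg phi k p)
    <= a ^+ (2 * k + 2).
Proof.
move=> p0; have [ss alg _] := threshold_alg_spec p0.
have ret0 : 0 < schedule_return p (threshold_alg phi k p).
  by rewrite -(pmulr_rgt0 _ a_gt0); apply: lt_le_trans alg; rewrite exprn_gt0.
rewrite ler_pdivrMr //; apply: ge_sup.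
  (* The supremum is over a nonempty set, as the empty schedule is feasible. *)
  by exists (schedule_return p [::]); exists [::].
by move=> _ [ts feas <-]; exact: schedule_return_le.
Qed.

End Threshold.

Theorem theorem4 (R : realType) (phi : R) (k : nat)
    (hphi : 1 < phi) (hk : (2 <= k)%N) :
  (competitive_ratio phi k (threshold_alg phi k)
     <= (phi `^ ((2 * k + 2)%:R / 3))%:E)%E.
Proof.
apply: ge_ereal_sup => _ [p [p0 [m [M [m0 Mm hp]]]] <-].
have phi0 : 0 <= phi by rewrite ltW // (lt_trans ltr01).
set a := phi `^ (1 / 3).
have a0 : 0 <= a by exact: powR_ge0.
have powE n : phi `^ (n%:R / 3) = a ^+ n.
  by rewrite -powR_mulrn // -powRrM; congr (_ `^ _); field.
have a3 : a ^+ 3 = phi by rewrite -powE divff ?powRr1.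
have a1 : 1 < a.
  rewrite ltNge; apply/negP => a_le1.
  by have := exprn_ile1 3 a0 a_le1; rewrite a3 leNgt hphi.
rewrite lee_fin powE; apply: (@opt_return_le _ phi a m) => //.
move=> x /hp; rewrite a3 -Mm divfK // gt_eqF //.
Qed.
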